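(* Let $\sigma$ be a completely erasing $k$-block substitution with $w_\epsilon\ne1^k$ that satisfies the optimality condition. Suppose $$\lim_{|w|\to\infty}\frac{|w|}{\epsilon(w)}=\infty,$$ meaning that for every $M>0$ there is $N$ such that $|w|/\epsilon(w)>M$ for all $w\in\{0,1\}^*$ with $|w|>N$. Then every point $x\in\mathbb I$ is a full entropy point of $f_\sigma$: for every closed neighborhood $K$ of $x$ in $\mathbb I$, $h(f_\sigma,K)=h(f_\sigma)=\infty$.
   Context: Notation: $\mathbb I=[0,1]$. $\{0,1\}^*$ and $\{0,1\}^\omega$ denote finite and infinite binary words, and $\epsilon$ is the empty word. For a word $w$, set $0.w=\sum_iw_i2^{-i}$. For $x\in(0,1]$, $\widetilde x$ is the unique infinite binary expansion of $x$ not ending in $0^\infty$. Fix $k\ge2$. An erasing $k$-block substitution is a map $\sigma:\{0,1\}^k\to\{0,1\}^*$ with exactly one block $w_\epsilon$ such that $\sigma(w_\epsilon)=\epsilon$. $\sigma$ is alternating if there are $\sigma_1,\dots,\sigma_k:\{0,1\}\to\{0,1\}^*$ with $\sigma(b_1\cdots b_k)=\sigma_1(b_1)\cdots\sigma_k(b_k)$. It is then extended to all finite or infinite words by $\sigma(u)=\prod_j\sigma_{((j-1)\bmod k)+1}(u_j)$. $\sigma$ is completely erasing if it is erasing and alternating, and every $w\in\{0,1\}^*$ satisfies $\sigma^n(w)=\epsilon$ for some $n\in\mathbb N$. The least such $n$ is the vanishing order $\epsilon(w)$. The map $f_\sigma:\mathbb I\to\mathbb I$ is defined by $f_\sigma(x)=0.\sigma(\widetilde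 x)$ if $x\in(0,1]$ and $\widetilde x\neq w_\epsilon^\infty$, and $f_\sigma(x)=0$ otherwise. Optimality condition: every $w\in\{0,1\}^\omega$ can be written as $w=\prod_{i\ge1}\sigma(b_i)$ with blocks $b_i\in\{0,1\}^k$ satisfying $\sigma(b_i)\ne\epsilon$. Topological entropy: let $d_n(x,y)=\max_{0\le i\le n}|f^i(x)-f^i(y)|$. A set $S$ is $(n,\delta)$-separated if $d_n(x,y)\ge\delta$ for all distinct $x,y\in S$. For $K\subseteq\mathbb I$, let $s_K(n,\delta)$ be the maximal cardinality of an $(n,\delta)$-separated subset of $K$. Then $h(f,K)=\lim_{\delta\to0}\limsup_{n\to\infty}\frac1n\log s_K(n,\delta)$ and $h(f)=h(f,\mathbb I)$. *)

(* Defs.v *)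
From HB Require Import structures.
From mathcomp Require Import all_boot all_order all_algebra.
From mathcomp Require Import all_classical all_reals all_analysis.
Set Implicit Arguments. Unset Strict Implicit. Unset Printing Implicit Defensive.
Import Order.TTheory GRing.Theory Num.Theory.
Import numFieldNormedType.Exports.
Local Open Scope classical_set_scope.
Local Open Scope ring_scope.

(* Finite words are [seq bool]; infinite words are [nat -> bool], position i
   (0-based) being the (i+1)-th letter. *)

(* An alternating k-block substitution is given by its components
   sig 0, ..., sig (k-1) : bool -> seq bool  (sigma_1,...,sigma_k of the paper;
   values of sig at indices >= k are never used).
   Extension to finite words: the j-th letter (0-based) is mapped by sig (j mod k). *)
Definition subst (k : nat) (sig : nat -> bool -> seq bool) (u : seq bool) : seq bool :=
  flatten [seq sig (j %% k)%N (nth false u j) | j <- iota 0 (size u)].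

Definition blocksub (k : nat) (sig : nat -> bool -> seq bool) (b : k.-tuple bool) : seq bool :=
  subst k sig b.

Definition erasing (k : nat) (sig : nat -> bool -> seq bool) : Prop :=
  exists! b : k.-tuple bool, blocksub sig b = [::].

(* completely erasing (alternation is built into the parametrization) *)
Definition completely_erasing (k : nat) (sig : nat -> bool -> seq bool) : Prop :=
  erasing k sig /\ forall w : seq bool, exists n, iter n (subst k sig) w = [::].

Definition vorder (k : nat) (sig : nat -> bool -> seq bool) (w : seq bool) : nat :=
  xget 0%N [set n | iter n (subst k sig) w = [::] /\
                    forall m, iter m (subst k sig) w = [::] -> (n <= m)%N].

Definition optimal (k : nat) (sig : nat -> bool -> seq bool) : Prop :=
  forall w : nat -> bool, exists bs : nat -> k.-tuple bool,
    (forall i, blocksub sig (bs i) != [::]) /\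
    forall n j, (j < size (flatten [seq blocksub sig (bs i) | i <- iota 0 n]))%N ->
      nth false (flatten [seq blocksub sig (bs i) | i <- iota 0 n]) j = w j.

Definition fval {R : realType} (w : seq bool) : R :=
  \sum_(i < size w) (nth false w i)%:R / 2 ^+ i.+1.

Definition ival {R : realType} (w : nat -> bool) : R :=
  limn (fun n => \sum_(i < n) (w i)%:R / (2 : R) ^+ i.+1).

Definition tilde {R : realType} (x : R) : nat -> bool :=
  xget (fun _ => true)
    [set w : nat -> bool | ival w = x /\ forall N, exists2 i, (N <= i)%N & w i].

Definition per (k : nat) (b : k.-tuple bool) : nat -> bool :=
  fun i => nth false b (i %% k)%N.

(* 0.sigma(u) for an infinite word u: sigma(u) is the limit of the images of
   the prefixes of u, so its value is the limit of the values of those images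
   (this covers both finite and infinite sigma(u)). *)
Definition val_subst_inf {R : realType} (k : nat) (sig : nat -> bool -> seq bool)
    (u : nat -> bool) : R :=
  limn (fun n => fval (R:=R) (subst k sig (mkseq u n))).

Definition fsig {R : realType} (k : nat) (sig : nat -> bool -> seq bool) (x : R) : R :=
  if `[< 0 < x <= 1 /\
        ~ (exists b : k.-tuple bool, blocksub sig b = [::] /\ tilde x = per b) >]
  then val_subst_inf k sig (tilde x) else 0.

Definition dn {R : realType} (f : R -> R) (n : nat) (x y : R) : R :=
  \big[Num.max/0]_(i < n.+1) `|iter i f x - iter i f y|.

Definition separated {R : realType} (f : R -> R) (n : nat) (delta : R) (S : seq R) : Prop :=
  forall x y, x \in S -> y \in S -> x != y -> delta <= dn f n x y.

Definition sK {R : realType} (f : R -> R) (K : set R) (n : nat) (delta : R) : \bar R :=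
  ereal_sup [set ((size S)%:R)%:E | S in
               [set S : seq R | uniq S /\ {subset S <= K} /\ separated f n delta S]].

Definition elog {R : realType} (e : \bar R) : \bar R :=
  match e with EFin r => (ln r)%:E | +oo%E => +oo%E | -oo%E => -oo%E end.

Definition hent {R : realType} (f : R -> R) (K : set R) : \bar R :=
  lim ((fun delta : R =>
          limn_esup (fun n : nat => ((n%:R)^-1)%:E * elog (sK f K n delta))%E)
       @ 0^'+).

Definition unit_interval {R : realType} : set R := [set x | 0 <= x <= 1].

Definition closed_nbhs_in_I {R : realType} (K : set R) (x : R) : Prop :=
  K `<=` unit_interval /\ closed K /\
  exists2 e : R, 0 < e & forall y, 0 <= y <= 1 -> `|y - x| < e -> K y.

(* Main.v *)
Require Import Defs.
From HB Require Import structures.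
From mathcomp Require Import all_boot all_order all_algebra.
From mathcomp Require Import all_classical all_reals all_analysis.
From mathcomp Require Import zify lra.
Set Implicit Arguments.
Unset Strict Implicit.
Import Order.TTheory GRing.Theory Num.Theory.
Import numFieldNormedType.Exports.
Local Open Scope classical_set_scope.
Local Open Scope ring_scope.

(* If v is a finite word and sigma^n(v) is empty, then every w in {0,1}^omega is
   sigma^n(v u) for some u: go back one step at a time, first completing the
   last block with erased letters, then using optimality.  Inserting the erased
   block between the chosen ones keeps every word of the orbit out of
   {0,1}^* 0^oo, so that f_sigma acts on it as sigma does.  Hence f_sigma^n maps
   each of the 2^L cylinders of words v of length L+1 ending in 0 over all points
   so obtained, with n = max eps(v); these cylinders are 2^-(L+1) apart,
   and this horseshoe, which can be entered from any neighborhood, gives entropy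
   at least L ln 2 / (n+1), unbounded since L / n tends to infinity. *)

(** * Substitution on words, and preimages of infinite words *)

Section Words.
Variables (k : nat) (sig : nat -> bool -> seq bool).
Hypothesis k0 : (0 < k)%N.

(** The condition by which [tilde] selects one expansion; on such words [ival] is injective. *)
Definition infinitely_many_ones (u : nat -> bool) : Prop :=
  forall N, exists2 i, (N <= i)%N & u i.

Lemma mkseq_cons (T : Type) (u : nat -> T) n :
  mkseq u n.+1 = u 0%N :: mkseq (u \o succn) n.
Proof. by rewrite /mkseq /= (iotaDl 1 0) -map_comp. Qed.

Lemma prefix_mkseq (T : eqType) (u : nat -> T) m n :
  (m <= n)%N -> prefix (mkseq u m) (mkseq u n).
Proof.
by move=> mn; rewrite -(subnKC mn) /mkseq iotaD map_cat prefix_prefix.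
Qed.

Lemma prefix_of_mkseq (T : eqType) (u : nat -> T) n (s : seq T) :
  prefix s (mkseq u n) -> s = mkseq u (size s).
Proof.
move=> sn; have sz : (size s <= n)%N by have := size_prefix sn; rewrite size_mkseq.
have := prefix_mkseq u sz; move: sn; rewrite !prefixE size_mkseq.
by move=> /eqP sn /eqP us; rewrite -[LHS]sn us.
Qed.

Lemma subst_rcons v b :
  subst k sig (rcons v b) = subst k sig v ++ sig (size v %% k)%N b.
Proof.
rewrite /subst size_rcons -addn1 iotaD map_cat flatten_cat /= cats0 add0n.
rewrite nth_rcons ltnn eqxx; congr (flatten _ ++ _).
apply/eq_in_map => j; rewrite mem_iota add0n /= => jv.
by rewrite nth_rcons jv.
Qed.

(** At a multiple of [k] the phase of the alternation is back at 0, so [v] is substituted as if it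
    stood alone. *)
Lemma subst_cat u v : (k %| size u)%N ->
  subst k sig (u ++ v) = subst k sig u ++ subst k sig v.
Proof.
move=> ku; elim/last_ind: v => [|v b IH]; first by rewrite !cats0.
rewrite -rcons_cat !subst_rcons IH size_cat catA.
by rewrite -modnDml (eqP ku) add0n.
Qed.

Lemma prefix_subst u v : prefix u v -> prefix (subst k sig u) (subst k sig v).
Proof.
case/prefixP => {v}w ->; elim/last_ind: w => [|w b IH]; first by rewrite cats0 prefix_refl.
by rewrite -rcons_cat subst_rcons; apply: (prefix_trans IH); exact: prefix_prefix.
Qed.

Lemma subst_eq_nil u : subst k sig u = [::] ->
  forall i, (i < size u)%N -> sig (i %% k)%N (nth false u i) = [::].
Proof.
elim/last_ind: u => // u b IH; rewrite subst_rcons => /(congr1 size)/eqP.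
rewrite size_cat addn_eq0 !size_eq0 => /andP[/eqP/IH{}IH /eqP sb] i.
rewrite size_rcons ltnS leq_eqVlt nth_rcons => /orP[/eqP ->|iu].
  by rewrite ltnn eqxx.
by rewrite iu; exact: IH.
Qed.

Section Erased.
Variable e : k.-tuple bool.
Hypothesis e_nil : blocksub sig e = [::].

Lemma erased_letter i : sig (i %% k)%N (nth false e (i %% k)%N) = [::].
Proof.
have := @subst_eq_nil e e_nil (i %% k)%N; rewrite size_tuple modn_mod.
by apply; rewrite ltn_mod.
Qed.

Lemma subst_per n : subst k sig (mkseq (per e) n) = [::].
Proof.
elim: n => // n IH.
by rewrite mkseqS subst_rcons IH size_mkseq erased_letter.
Qed.

(** By alternation, each letter of the erased block is erased on its own at its phase, so padding
    can start at any phase. *)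
Lemma erased_padding v m :
  exists2 p, size p = m & subst k sig (v ++ p) = subst k sig v.
Proof.
elim: m => [|m [p sp ep]]; first by exists [::]; rewrite ?cats0.
exists (rcons p (nth false e (size (v ++ p) %% k)%N)).
  by rewrite size_rcons sp.
by rewrite -rcons_cat subst_rcons ep erased_letter cats0.
Qed.

End Erased.

(* w = sigma(u), read on prefixes *)
Definition subst_inf (u w : nat -> bool) : Prop :=
  forall m, exists2 n, (m <= size (subst k sig (mkseq u n)))%N &
    subst k sig (mkseq u n) = mkseq w (size (subst k sig (mkseq u n))).

(** Images of prefixes form a chain for the prefix order, so agreement with [w] along arbitrarily
    long images passes to all of them. *)
Lemma subst_infP u w n : subst_inf u w ->
  subst k sig (mkseq u n) = mkseq w (size (subst k sig (mkseq u n))).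
Proof.
move=> uw; have [N sN eN] := uw (size (subst k sig (mkseq u n))).
have [nN|/ltnW Nn] := leqP n N.
  apply: (@prefix_of_mkseq _ _ (size (subst k sig (mkseq u N)))).
  by rewrite -eN prefix_subst// prefix_mkseq.
have := prefix_subst (prefix_mkseq u Nn).
by rewrite prefixE take_oversize// => /eqP ->.
Qed.

(** The limit takes its letter [j] from [P j.+1], whose length is guaranteed to exceed [j]. *)
Lemma prefix_limit (P : nat -> seq bool) :
  (forall m, prefix (P m) (P m.+1)) -> (forall m, (m <= size (P m))%N) ->
  exists u, forall m, P m = mkseq u (size (P m)).
Proof.
move=> Pp Ps.
have Pm m n : (m <= n)%N -> prefix (P m) (P n).
  move=> /subnKC <-; elim: (n - m)%N => [|d IH]; first by rewrite addn0 prefix_refl.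
  by rewrite addnS; exact: prefix_trans IH (Pp _).
have nthP m n j : (m <= n)%N -> (j < size (P m))%N ->
    nth false (P n) j = nth false (P m) j.
  by move=> /Pm /prefixP[s ->] js; rewrite nth_cat js.
exists (fun j => nth false (P j.+1) j) => m.
apply: (@eq_from_nth _ false) => [|j jm]; first by rewrite size_mkseq.
rewrite nth_mkseq//; have [mj|/ltnW jm'] := leqP m j.+1.
  by rewrite (nthP m j.+1).
by rewrite (nthP j.+1 m)//; exact: Ps.
Qed.

(* The preimage is v, then erased letters completing the last block, then
   e b_1 e b_2 ... with e the erased block: of any two consecutive blocks e b_i
   one is not 0^k, so that the word does not end in 0^oo. *)
Lemma subst_inf_preimage v w : completely_erasing k sig -> optimal k sig ->
  subst k sig v = mkseq w (size (subst k sig v)) ->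
  exists u, [/\ infinitely_many_ones u, mkseq u (size v) = v & subst_inf u w].
Proof.
move=> [[e [e_nil e_uniq]] _] opt vw.
set l := size (subst k sig v) in vw.
(* Optimality is applied to what remains of [w] after the image of [v]. *)
have [bs [bs_nil bsw]] := opt (fun j => w (l + j)%N).
pose F m := flatten [seq blocksub sig (bs i) | i <- iota 0 m].
have FS m : F m.+1 = F m ++ blocksub sig (bs m).
  by rewrite /F -addn1 iotaD map_cat flatten_cat /= cats0.
(* If [k] divides [size v], the padding is a whole erased block, which is harmless. *)
have [p sp ep] := erased_padding e_nil v (k - size v %% k).
pose c i : seq bool := e ++ bs i.
pose P m := (v ++ p) ++ flatten [seq c i | i <- iota 0 m].
have PS m : P m.+1 = P m ++ c m.
  by rewrite /P -addn1 iotaD map_cat flatten_cat /= cats0 catA.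
have kP m : (k %| size (P m))%N.
  elim: m => [|m IH].
    rewrite /P cats0 size_cat sp {1}(divn_eq (size v) k) -addnA subnKC.
      by rewrite -mulSnr dvdn_mull.
    by rewrite ltnW// ltn_mod.
  rewrite PS size_cat dvdn_add// /c size_cat !size_tuple.
  by rewrite dvdn_add.
have sP m : (m <= size (P m))%N.
  elim: m => // m IH; rewrite PS size_cat /c size_cat !size_tuple; lia.
have Pp m : prefix (P m) (P m.+1) by rewrite PS prefix_prefix.
have substP m : subst k sig (P m) = subst k sig v ++ F m.
  elim: m => [|m IH]; first by rewrite /P /F /= !cats0.
  rewrite PS subst_cat// IH FS /c subst_cat ?size_tuple//.
  by rewrite [subst k sig e]e_nil cat0s -catA.
have sF m : (m <= size (F m))%N.
  elim: m => // m IH; rewrite FS size_cat -addn1 leq_add// lt0n size_eq0.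
  exact: bs_nil.
have Fw m : subst k sig (P m) = mkseq w (size (subst k sig (P m))).
  rewrite substP size_cat -/l /mkseq iotaD map_cat [subst k sig v in LHS]vw.
  congr cat; rewrite add0n -[X in iota X _]addn0 iotaDl -map_comp.
  apply: (@eq_from_nth _ false) => [|j jF]; first by rewrite size_map size_iota.
  rewrite bsw// (nth_map 0%N) ?size_iota// nth_iota//.
have [u Pu] := prefix_limit Pp sP.
exists u; split.
- move=> N; have [i ic ci] : exists2 i, (i < size (c N))%N & nth false (c N) i.
    apply/(@has_nthP _ id _ false) => /=; rewrite /c has_cat; apply/orP.
    (* Two blocks of zeros would be equal, but [e] is erased and [bs N] is not. *)
    have [|ne] := boolP (has id e); [by left|right].
    apply: contraNT (bs_nil N) => nb; rewrite -[X in _ == X]e_nil; apply/eqP.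
    congr blocksub; apply: eq_from_tnth => i.
    move: ne nb => /hasPn ne /hasPn nb.
    have /negPf -> := ne _ (mem_tnth i e).
    by have /negPf -> := nb _ (mem_tnth i (bs N)).
  exists (size (P N) + i)%N; first by rewrite (leq_trans (sP N))// leq_addr.
  have sNi : (size (P N) + i < size (P N.+1))%N by rewrite PS size_cat ltn_add2l.
  rewrite -(nth_mkseq false u sNi) -Pu PS nth_cat ltnNge leq_addr /=.
  by rewrite addKn.
- symmetry; apply: (@prefix_of_mkseq _ _ (size (P 0%N))).
  by rewrite -Pu /P -catA prefix_prefix.
- move=> m; exists (size (P m)); rewrite -Pu; last exact: Fw.
  by rewrite substP size_cat (leq_trans (sF m))// leq_addl.
Qed.

End Words.

(** * Binary expansions and the action of [fsig] on them *)

Section Binary.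
Context {R : realType}.
Implicit Types (u w : nat -> bool) (x : R).
Local Notation psum u n := (\sum_(i < n) (u i)%:R / (2 : R) ^+ i.+1).

Lemma psumS u n : psum u n.+1 = ((u 0%N)%:R + psum (u \o succn) n) / 2.
Proof.
rewrite big_ord_recl /= expr1 mulrDl mulr_suml; congr (_ + _).
apply: eq_bigr => i _; rewrite /bump /= add1n [_ ^+ i.+2]exprSr.
by rewrite invfM mulrA.
Qed.

Lemma psum_ge0 u n : 0 <= psum u n.
Proof. by apply: sumr_ge0 => i _; rewrite divr_ge0// exprn_ge0. Qed.

Lemma psum_le1 u n : psum u n <= 1.
Proof.
elim: n u => [|n IH] u; first by rewrite big_ord0.
by rewrite psumS; have := IH (u \o succn); case: (u 0%N) => /=; lra.
Qed.

Lemma cvg_psum u : (fun n => psum u n) @ \oo --> (ival u : R).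
Proof.
apply: nondecreasing_is_cvgn.
  apply/nondecreasing_seqP => n; rewrite big_ord_recr /= lerDl.
  by rewrite divr_ge0// exprn_ge0.
by exists 1 => _ [n _ <-]; exact: psum_le1.
Qed.

Lemma ival_cons u : (ival u : R) = ((u 0%N)%:R + ival (u \o succn)) / 2.
Proof.
apply: (@cvg_unique _ _ ((fun n => psum u n.+1) @ \oo)) => //.
  by have := @cvg_psum u; rewrite -(cvg_shiftS (fun n => psum u n)).
rewrite (_ : (fun n => psum u n.+1) =
    fun n => ((u 0%N)%:R + psum (u \o succn) n) / 2); last first.
  by apply/funext => n; rewrite psumS.
apply: cvgM; last exact: cvg_cst.
by apply: cvgD; [exact: cvg_cst|exact: cvg_psum].
Qed.

Lemma ival_ge0 u : 0 <= (ival u : R).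
Proof.
apply: limr_ge; first by apply/cvg_ex; exists (ival u); exact: cvg_psum.
by apply: nearW => n; exact: psum_ge0.
Qed.

Lemma ival_le1 u : (ival u : R) <= 1.
Proof.
apply: limr_le; first by apply/cvg_ex; exists (ival u); exact: cvg_psum.
by apply: nearW => n; exact: psum_le1.
Qed.

Lemma infinitely_many_ones_tail u :
  infinitely_many_ones u -> infinitely_many_ones (u \o succn).
Proof.
move=> iu N; have [i Ni ui] := iu N.+1; exists i.-1 => /=.
  by rewrite -ltnS (ltn_predK Ni).
by rewrite (ltn_predK Ni).
Qed.

Lemma ival_gt0 u : infinitely_many_ones u -> 0 < (ival u : R).
Proof.
move=> /(_ 0%N)[i _]; elim: i u => [|i IH] u ui; rewrite ival_cons.
  by rewrite ui; have := ival_ge0 (u \o succn) => /=; lra.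
by have := IH (u \o succn) ui; case: (u 0%N) => /=; lra.
Qed.

(** Tails have values in (0,1], so the first letter is 1 exactly when the value exceeds 1/2;
    induction on the position peels off the letters. *)
Lemma ival_inj u w : infinitely_many_ones u -> infinitely_many_ones w ->
  (ival u : R) = ival w -> u = w.
Proof.
move=> iu iw uw; apply/funext => i; elim: i u w iu iw uw => [|i IH] u w iu iw.
  rewrite [ival u]ival_cons [ival w]ival_cons.
  have := ival_gt0 (infinitely_many_ones_tail iu).
  have := ival_gt0 (infinitely_many_ones_tail iw).
  have := ival_le1 (u \o succn); have := ival_le1 (w \o succn).
  by case: (u 0%N); case: (w 0%N) => //= *; lra.
move=> uw.
have u0 : u 0%N = w 0%N.
  move: uw; rewrite [ival u]ival_cons [ival w]ival_cons.
  have := ival_gt0 (infinitely_many_ones_tail iu).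
  have := ival_gt0 (infinitely_many_ones_tail iw).
  have := ival_le1 (u \o succn); have := ival_le1 (w \o succn).
  by case: (u 0%N); case: (w 0%N) => //= *; lra.
apply: (IH (u \o succn) (w \o succn)).
- exact: infinitely_many_ones_tail.
- exact: infinitely_many_ones_tail.
- by move: uw; rewrite [ival u]ival_cons [ival w]ival_cons u0; lra.
Qed.

Lemma tilde_ival u : infinitely_many_ones u -> tilde (ival u : R) = u.
Proof.
move=> iu; rewrite /tilde.
by case: xgetP => [w -> [wu iw]|/(_ u)[]//]; exact: ival_inj.
Qed.

Lemma ival_le_of_zero u n : u n = false ->
  (ival u : R) <= 1 - 2^-1 ^+ n.+1.
Proof.
elim: n u => [|n IH] u un; rewrite ival_cons.
  by rewrite un expr1; have := ival_le1 (u \o succn) => /=; lra.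
have := IH (u \o succn) un; rewrite [_ ^+ n.+2]exprS.
by case: (u 0%N) => /=; lra.
Qed.

(** The 0 at position [n] confines each value to the left half of a dyadic interval of length 2^-n,
    and left halves of distinct such intervals are at least 2^-(n+1) apart. In the induction, equal
    first letters halve the distance and different ones leave the gap of [ival_le_of_zero]. *)
Lemma ival_separated n u w : u n = false -> w n = false ->
  mkseq u n != mkseq w n -> 2^-1 ^+ n.+1 <= `|ival u - ival w : R|.
Proof.
elim: n u w => [|n IH] u w un wn; first by rewrite eqxx.
rewrite !mkseq_cons eqseq_cons negb_and.
rewrite [ival u]ival_cons [ival w]ival_cons exprS.
have := ival_ge0 (u \o succn); have := ival_ge0 (w \o succn).
have := ival_le_of_zero (u := u \o succn) un.
have := ival_le_of_zero (u := w \o succn) wn.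
have := IH (u \o succn) (w \o succn) un wn.
case: (eqVneq (u 0%N) (w 0%N)) => [->|] /=.
  move=> H _ _ _ _ /H h.
  rewrite -mulrBl opprD addrACA subrr add0r normrM mulrC.
  by rewrite [`|2^-1|]gtr0_norm ?invr_gt0// ler_pM2r// invr_gt0.
have : 0 <= (2^-1 : R) ^+ n.+1 by rewrite exprn_ge0// invr_ge0.
move=> h0 + _ h1 h2 h3 h4 _.
case: (u 0%N); case: (w 0%N) => //= _.
- by rewrite ger0_norm; lra.
- by rewrite ler0_norm; lra.
Qed.

(** Each letter of [v] picks a half of the interval containing [x], which is then rescaled. The
    whole cylinder of [v] lies near [x], as entering a neighborhood requires. *)
Lemma ival_approx n x : 0 <= x <= 1 ->
  exists v : seq bool, forall u, mkseq u (size v) = v ->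
    `|ival u - x| <= 2^-1 ^+ n.
Proof.
elim: n x => [|n IH] x x01.
  exists [::] => u _; rewrite expr0 ler_norml.
  by have := ival_ge0 u; have := ival_le1 u; lra.
pose b := (2^-1 < x).
have [|v hv] := IH (2 * x - b%:R).
  by rewrite /b; case: ltP => /=; lra.
exists (b :: v) => u; rewrite /= mkseq_cons => -[u0 /hv].
rewrite [ival u]ival_cons u0 !ler_norml exprS; lra.
Qed.

(** Infinitely many ones make [tilde] return [u] itself, and the images of the prefixes of [u] grow
    without bound inside [w], so their values tend to that of [w]. *)
Lemma fsig_ival k sig u w : (0 < k)%N ->
  infinitely_many_ones u -> subst_inf k sig u w ->
  fsig k sig (ival u : R) = ival w.
Proof.
move=> k0 iu uw; rewrite /fsig tilde_ival//; case: asboolP; last first.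
  case; split; first by rewrite ival_gt0// ival_le1.
  (* On an erased periodic word every prefix has empty image, whereas [uw] yields an image of length
     at least 1. *)
  move=> [b [b_nil ub]]; have [n] := uw 1%N.
  by rewrite ub subst_per.
move=> _; rewrite /val_subst_inf.
apply/cvg_lim => //.
pose s n := size (subst k sig (mkseq u n)).
have -> : (fun n => fval (subst k sig (mkseq u n))) = (fun n => psum w n) \o s.
  apply/funext => n /=; rewrite /fval; apply: eq_bigr => i _.
  by rewrite {1}(subst_infP n uw) nth_mkseq.
apply: cvg_comp (@cvg_psum w).
move=> A [N _ NA]; have [n Nn _] := uw N; exists n => // m /= nm.
apply: NA => /=; apply: (leq_trans Nn).
by apply: size_prefix; apply: prefix_subst; exact: prefix_mkseq.
Qed.

(** Induction on [n]: the word found for the image of [v] is pulled back one step with prefix [v].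
    The ones present in each preimage let [fsig_ival] apply along the orbit. *)
Lemma iter_fsig_preimage k sig n v w : (0 < k)%N ->
  completely_erasing k sig -> optimal k sig ->
  iter n (subst k sig) v = [::] -> infinitely_many_ones w ->
  exists u, [/\ infinitely_many_ones u, mkseq u (size v) = v &
    iter n (fsig k sig) (ival u : R) = ival w].
Proof.
move=> k0 ce opt + iw; elim: n v => [|n IH] v; first by move=> /= ->; exists w.
rewrite iterSr => /IH[u' [iu' vu' eu']].
have [u [iu uv uu']] := subst_inf_preimage k0 ce opt (esym vu').
by exists u; split=> //; rewrite iterSr (fsig_ival k0 iu uu').
Qed.

End Binary.

(** * Entropy lower bounds from horseshoes *)

Section Entropy.
Context {R : realType}.
Implicit Types (f : R -> R) (K : set R).

(** Every tail supremum dominates a bound that recurs at arbitrarily large times; the horseshoe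
    count is made only at times [n0 + n * m]. *)
Lemma le_limn_esup (u : (\bar R)^nat) (a : \bar R) :
  (forall N, exists2 n, (N <= n)%N & (a <= u n)%E) -> (a <= limn_esup u)%E.
Proof.
move=> au; apply: le_ereal_inf_tmp => _ [V [N _ NV] <-].
have [n Nn aun] := au N; apply: (le_trans aun).
by apply: ereal_sup_ubound; exists n => //; exact: NV.
Qed.

Lemma le_dn f n i x y : (i <= n)%N ->
  `|iter i f x - iter i f y| <= dn f n x y.
Proof.
rewrite -ltnS => lin.
exact: (le_bigmax 0 (fun j : 'I_n.+1 => `|iter j f x - iter j f y|) (Ordinal lin)).
Qed.

Lemma le_elog_sK f K n (delta : R) (S : seq R) :
  uniq S -> {subset S <= K} -> Defs.separated f n delta S -> (0 < size S)%N ->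
  ((ln (size S)%:R)%:E <= elog (sK f K n delta))%E.
Proof.
move=> uS SK sepS S0.
have : ((size S)%:R%:E <= sK f K n delta)%E.
  by apply: ereal_sup_ubound; exists S.
case: (sK f K n delta) => [r| |] //=; last by move=> _; exact: leey.
rewrite !lee_fin => Sr; rewrite ler_ln// posrE ?ltr0n//.
by apply: lt_le_trans Sr; rewrite ltr0n.
Qed.

(** The [g i] are inverse branches of the [n]-th iterate on [G], so that iterate strips the first
    letter of a code; codes first differing at position q are told apart at time n q. *)
Lemma foldr_branches_separated (I : eqType) f (g : I -> R -> R) (G : set R)
    (n : nat) (d : R) :
  (forall i y, G y -> G (g i y)) ->
  (forall i y, G y -> iter n f (g i y) = y) ->
  (forall i j y z, G y -> G z -> i != j -> d <= `|g i y - g j z|) ->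
  forall y s t, G y -> size s = size t -> s != t ->
  exists2 j, (j <= n * size s)%N &
    d <= `|iter j f (foldr g y s) - iter j f (foldr g y t)|.
Proof.
move=> gG fg gd y s t Gy; have GG u : G (foldr g y u).
  by elim: u => //= i u; exact: gG.
elim: s t => [|i s IH] [|j t] //= [st]; rewrite eqseq_cons negb_and.
have [<-|ij _] := eqVneq i j => /=.
  move=> /(IH _ st)[m ms dm]; exists (m + n)%N; last by rewrite !iterD !fg.
  by rewrite mulnS addnC leq_add2l.
by exists 0%N => //=; exact: gd.
Qed.

(** Codes of length [m], brought into [K] by the entry branch [g0], give [#|I| ^ m] distinct
    separated points. *)
Lemma horseshoe_growth (I : finType) f (g : I -> R -> R) (g0 : R -> R)
    (G K : set R) (n0 n : nat) (d : R) (y : R) :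
  (0 < #|I|)%N -> 0 < d -> G y ->
  (forall i y, G y -> G (g i y)) ->
  (forall i y, G y -> iter n f (g i y) = y) ->
  (forall i j y z, G y -> G z -> i != j -> d <= `|g i y - g j z|) ->
  (forall y, G y -> K (g0 y)) ->
  (forall y, G y -> iter n0 f (g0 y) = y) ->
  forall delta m, delta <= d ->
  (((ln #|I|%:R) *+ m)%:E <= elog (sK f K (n0 + n * m) delta))%E.
Proof.
move=> I0 d0 Gy gG fg gd g0K fg0 delta m dd.
have GG u : G (foldr g y u) by elim: u => //= i u; exact: gG.
pose h (t : m.-tuple I) := g0 (foldr g y t).
have sep s t : s != t -> d <= dn f (n0 + n * m) (h s) (h t).
  move=> st; have sz : size s = size t by rewrite !size_tuple.
  have [j js dj] := foldr_branches_separated gG fg gd Gy sz st.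
  (* The entry branch delays the separation by [n0] iterations. *)
  apply: (le_trans dj); rewrite -{1}(fg0 _ (GG s)) -{1}(fg0 _ (GG t)) -!iterD.
  by apply: le_dn; rewrite addnC leq_add2l (leq_trans js)// size_tuple.
have dn0 x : dn f (n0 + n * m) x x = 0.
  rewrite /dn; apply/eqP; rewrite eq_le bigmax_ge_id andbT.
  by apply: bigmax_le => // i _; rewrite subrr normr0.
have hI : injective h.
  move=> s t hst; apply: contraTeq isT => /sep.
  by rewrite hst dn0 leNgt d0.
have := @le_elog_sK f K (n0 + n * m) delta (map h (enum {: m.-tuple I})).
rewrite size_map -cardE card_tuple natrX lnXn ?ltr0n//; apply.
- by rewrite map_inj_uniq// enum_uniq.
- by move=> _ /mapP[t _ ->]; rewrite inE; exact: g0K.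
- move=> _ _ /mapP[s _ ->] /mapP[t _ ->] hst; apply: (le_trans dd).
  by apply: sep; apply: contraNneq hst => ->.
- by rewrite expn_gt0 I0.
Qed.

(** Dividing by [n.+1] instead of [n] absorbs the transient [n0], because n0 + n m <= (n+1) m once m
    >= n0. *)
Lemma le_hent_horseshoe (I : finType) f (g : I -> R -> R) (g0 : R -> R)
    (G K : set R) (n0 n : nat) (d : R) (y : R) :
  (0 < #|I|)%N -> (0 < n)%N -> 0 < d -> G y ->
  (forall i y, G y -> G (g i y)) ->
  (forall i y, G y -> iter n f (g i y) = y) ->
  (forall i j y z, G y -> G z -> i != j -> d <= `|g i y - g j z|) ->
  (forall y, G y -> K (g0 y)) ->
  (forall y, G y -> iter n0 f (g0 y) = y) ->
  forall delta, delta <= d ->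
  ((ln #|I|%:R / n.+1%:R)%:E <= limn_esup
     (fun n : nat => ((n%:R)^-1)%:E * elog (sK f K n delta)))%E.
Proof.
move=> I0 npos d0 Gy gG fg gd g0K fg0 delta dd.
apply: le_limn_esup => N; pose m := (n0 + N).+1.
exists (n0 + n * m)%N; first by rewrite /m; nia.
have lnI : 0 <= ln #|I|%:R :> R by rewrite ln_ge0// ler1n.
have T0 : 0 < (n0 + n * m)%:R :> R by rewrite ltr0n /m; nia.
have := horseshoe_growth I0 d0 Gy gG fg gd g0K fg0 m dd.
move=> /(@lee_wpmul2l _ ((n0 + n * m)%:R^-1)%:E); rewrite lee_fin invr_ge0 ler0n.
move=> /(_ isT); apply: le_trans; rewrite -EFinM lee_fin.
rewrite [leRHS]mulrC ler_pdivrMr ?ltr0n// mulrAC ler_pdivlMr// -[_ *+ m]mulr_natr.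
by rewrite -mulrA ler_wpM2l// -natrM ler_nat /m; nia.
Qed.

Lemma hent_eq_pinfty f K :
  (forall A : R, exists2 d : R, 0 < d & forall delta, 0 < delta -> delta <= d ->
     (A%:E <= limn_esup
       (fun n : nat => ((n%:R)^-1)%:E * elog (sK f K n delta)))%E) ->
  hent f K = +oo%E.
Proof.
move=> H; apply/cvg_lim => //; apply/cvgeyPge => A.
have [d d0 hd] := H A; near=> delta; apply: hd.
  by near: delta; exact: nbhs_right_gt.
by near: delta; exact: nbhs_right_le.
Unshelve. all: by end_near. Qed.

End Entropy.

(** * Horseshoes of completely erasing substitutions *)

Section Erasing.
Variables (R : realType) (k : nat) (sig : nat -> bool -> seq bool).
Hypotheses (k0 : (0 < k)%N) (ce : completely_erasing k sig)
  (opt : optimal k sig).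
Local Notation f := (@fsig R k sig).

(** The common domain of all inverse branches, given by words so that each point comes with an
    expansion to pull back. *)
Let G : set R := [set ival u | u in infinitely_many_ones].

Lemma G_nonempty : exists y, G y.
Proof. by exists (ival (fun=> true)), (fun=> true) => // N; exists N. Qed.

(** Complete erasure makes the set defining [vorder] nonempty, so [xget] does not fall back on its
    default 0. *)
Lemma vorderP w : iter (vorder k sig w) (subst k sig) w = [::].
Proof.
rewrite /vorder; case: xgetP => [n _ [//]|/= none].
have [n wn] := ce.2 w.
have ex : exists n, iter n (subst k sig) w == [::] by exists n; exact/eqP.
case: (ex_minnP ex) => m /eqP mw mmin.
by case: (none m); split=> // p /eqP; exact: mmin.
Qed.

Lemma iter_subst_nil n m w : (m <= n)%N ->
  iter m (subst k sig) w = [::] -> iter n (subst k sig) w = [::].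
Proof. by move=> /subnK <- wm; rewrite iterD wm; elim: (n - m)%N => // p /= ->. Qed.

(** Choice turns the preimages of [iter_fsig_preimage] into an inverse branch with values in the
    cylinder of [v]; outside [G] the value 0 is a filler. *)
Lemma cylinder_section n v : iter n (subst k sig) v = [::] ->
  exists g : R -> R, forall y, G y ->
    iter n f (g y) = y /\
    exists u, [/\ infinitely_many_ones u, mkseq u (size v) = v & g y = ival u].
Proof.
move=> vn.
have H y : exists x, G y -> iter n f x = y /\
    exists u, [/\ infinitely_many_ones u, mkseq u (size v) = v & x = ival u].
  have [[w iw <-]|nG] := pselect (G y); last by exists 0.
  have [u [iu uv uw]] := @iter_fsig_preimage R _ _ _ _ _ k0 ce opt vn iw.
  by exists (ival u) => _; split=> //; exists u.
by have [g hg] := choice H; exists g.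
Qed.

(** The branches are indexed by the words [t], and the appended 0 is what separates their
    cylinders. *)
Lemma le_esup_fsig K x L n : 0 <= x <= 1 ->
  (exists2 e : R, 0 < e & forall y, 0 <= y <= 1 -> `|y - x| < e -> K y) ->
  (0 < n)%N ->
  (forall t : L.-tuple bool, iter n (subst k sig) (rcons t false) = [::]) ->
  forall delta, delta <= 2^-1 ^+ L.+1 ->
  ((ln 2 * L%:R / n.+1%:R)%:E <= limn_esup
     (fun n : nat => ((n%:R)^-1)%:E * elog (sK f K n delta)))%E.
Proof.
move=> x01 [e e0 Ke] npos nilL.
have [y0 Gy0] := G_nonempty.
have [p pe] : exists p, (2^-1 : R) ^+ p < e.
  have c0 : (fun p => (2^-1 : R) ^+ p) @ \oo --> (0 : R).
    by apply: cvg_expr; rewrite gtr0_norm; lra.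
  move/cvgrPdist_lt : c0 => /(_ _ e0)[p _ /(_ p (leqnn p))] /=.
  by rewrite sub0r normrN => pe; exists p; exact: le_lt_trans (ler_norm _) pe.
(* The cylinder of [v0] lies within [e] of [x]; its vanishing order is the transient time. *)
have [v0 v0x] := @ival_approx R p x x01.
have [g0 g0P] := cylinder_section (vorderP v0).
have [g gP] := choice (fun t => cylinder_section (nilL t)).
have lnE : ln #|{: L.-tuple bool}|%:R = ln 2 * L%:R :> R.
  by rewrite card_tuple card_bool natrX lnXn// mulr_natr.
rewrite -lnE.
apply: (@le_hent_horseshoe R {: L.-tuple bool} f g g0 G K (vorder k sig v0) n
  (2^-1 ^+ L.+1) y0) => //.
- by rewrite card_tuple card_bool expn_gt0.
- by move=> t y /(gP t)[_ [u [iu _ ->]]]; exists u.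
- by move=> t y /(gP t)[].
- move=> s t y z /(gP s)[_ [u [_ us ->]]] /(gP t)[_ [w [_ wt ->]]] st.
  have pre a (r : L.-tuple bool) : mkseq a (size (rcons r false)) = rcons r false ->
      a L = false /\ mkseq a L = r.
    rewrite size_rcons size_tuple mkseqS => /eqP; rewrite eqseq_rcons.
    by case/andP => /eqP -> /eqP ->.
  have [uL us'] := pre _ _ us; have [wL wt'] := pre _ _ wt.
  by apply: ival_separated => //; rewrite us' wt'.
- move=> y /g0P[_ [u [_ uv0 ->]]]; apply: Ke.
    by rewrite ival_ge0 ival_le1.
  exact: le_lt_trans (v0x _ uv0) pe.
- by move=> y /g0P[].
Qed.

Lemma hent_fsig K x : 0 <= x <= 1 ->
  (exists2 e : R, 0 < e & forall y, 0 <= y <= 1 -> `|y - x| < e -> K y) ->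
  (forall M : R, 0 < M -> exists N : nat, forall w : seq bool,
      (N < size w)%N -> M < (size w)%:R / (vorder k sig w)%:R) ->
  hent f K = +oo%E.
Proof.
move=> x01 Kx hM; apply: hent_eq_pinfty => A.
have ln2 : 0 < ln 2 :> R by rewrite ln_gt0// ltr1n.
(* The 4 pays for n + 1 <= 2 n and L + 1 <= 2 L in the final estimate; adding 1 to the norm keeps
   [M] positive when [A] is 0. *)
pose M := 4 * (`|A| + 1) / ln 2.
have M0 : 0 < M by rewrite divr_gt0// mulr_gt0// ltr_wpDl.
have [N hN] := hM M M0; pose L := N.+1.
(* All branches need one common return time; the growth hypothesis is used at a word attaining this
   maximum. *)
pose n := (\max_(t : L.-tuple bool) vorder k sig (rcons t false))%N.
have [t nt] : exists t : L.-tuple bool, n = vorder k sig (rcons t false).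
  have [|t _ nt] := @eq_bigmax_cond _ predT
      (fun t : L.-tuple bool => vorder k sig (rcons t false)).
    by rewrite card_tuple card_bool expn_gt0.
  by exists t.
have nM : M < L.+1%:R / n%:R.
  by have := hN (rcons t false); rewrite size_rcons size_tuple nt; apply.
(* For [n] equal to 0 the quotient would be 0 by the convention on division, contradicting [nM]. *)
have npos : (0 < n)%N.
  by rewrite lt0n; apply: contraTneq nM => ->; rewrite invr0 mulr0 -leNgt ltW.
exists (2^-1 ^+ L.+1); first by rewrite exprn_gt0// invr_gt0.
move=> delta _ dd.
have := @le_esup_fsig K x L n x01 Kx npos _ delta dd.
have nilL (s : L.-tuple bool) : iter n (subst k sig) (rcons s false) = [::].
  by apply: iter_subst_nil (vorderP _); rewrite /n (leq_bigmax s).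
move=> /(_ nilL); apply: le_trans; rewrite lee_fin.
apply: (le_trans (ler_norm A)).
have n1 : 1 <= n%:R :> R by rewrite ler1n.
have L1 : 1 <= L%:R :> R by rewrite ler1n.
move: nM; rewrite ltr_pdivlMr; last by rewrite ltr0n.
rewrite /M mulrAC ltr_pdivrMr// => nM.
rewrite ler_pdivlMr ?ltr0n//.
rewrite -[L.+1%:R]natr1 in nM; rewrite -natr1.
have := normr_ge0 A; nra.
Qed.

End Erasing.

Unset Implicit Arguments.
Set Strict Implicit.

Theorem mainTheorem19 (R : realType) (k : nat) (sig : nat -> bool -> seq bool) :
  (2 <= k)%N ->
  completely_erasing k sig ->
  (forall b : k.-tuple bool, blocksub sig b = [::] -> b != [tuple of nseq k true]) ->
  optimal k sig ->
  (forall M : R, 0 < M -> exists N : nat, forall w : seq bool,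
      (N < size w)%N -> M < (size w)%:R / (vorder k sig w)%:R) ->
  forall (x : R), 0 <= x <= 1 ->
  forall K : set R, closed_nbhs_in_I K x ->
    hent (fsig k sig) K = +oo%E /\ hent (fsig k sig) (@unit_interval R) = +oo%E.
Proof.
move=> k2 ce _ opt hM x x01 K [_ [_ Kx]].
have k0 : (0 < k)%N by exact: ltnW.
split; first exact: hent_fsig x01 Kx hM.
by apply: hent_fsig x01 _ hM => //; exists 1.
Qed.
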